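(* Let $H$ be a representation-finite hereditary algebra, let $m\geq 2$, let $\mathcal T$ be an $n$-cluster tilting subcategory of the $m$-cluster category $\mathcal C_m(H)$, and let $\mathcal X$ be the preimage of $\mathcal T$ in $\mathcal D^b(H)$ under the projection $\pi_m:\mathcal D^b(H)\to\mathcal C_m(H)$. If $F_{\mathcal C}:\mathcal C_m(H)\rightarrow \mathcal C_m(H)$ is a functor of the form $\tau^s[t]$ (with $s,t\in\mathbb Z$) and $\mathcal T$ is $F_{\mathcal C}$-periodic, then $\mathcal X$ is periodic under the functor $F_{\mathcal D^b}=\tau^s[t]:\mathcal D^b(H)\rightarrow \mathcal D^b(H)$.
   Context: $\mathcal D^b(H)$ is the bounded derived category of finitely generated $H$-modules. In each category $[1]$ denotes the suspension functor and $\tau$ the Auslander-Reiten translate. The $m$-cluster category is the orbit category $\mathcal C_m(H)=\mathcal D^b(H)/\tau^{-1}[m-1]$; it has the same objects as $\mathcal D^b(H)$ and morphisms $\bigoplus_{p\in\mathbb Z}\mathrm{Hom}_{\mathcal D^b(H)}(X,G^pY)$ with $G=\tau^{-1}[m-1]$. It is known that $\mathcal C_m(H)$ is triangulated and that the projection $\pi_m$ is a triangle functor. Subcategories are full and closed under isomorphism; the preimage of $\mathcal T$ is the full subcategory of objects $X$ with $\pi_m(X)\in\mathcal T$. A subcategory $\mathcal X$ is periodic under an autoequivalence $F$ (or $F$-periodic) if $F\mathcal X=\mathcal X$. A functorially finite subcategory $\mathcal X$ of a triangulated category $\mathcal C$ is $n$-cluster tilting if $\mathcal X=\{Z\mid \mathrm{Hom}_{\mathcal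 C}(\mathcal X,Z[i])=0\text{ for }0<i<n\}=\{Z\mid \mathrm{Hom}_{\mathcal C}(Z,\mathcal X[i])=0\text{ for }0<i<n\}$. *)

(* Defs.v *)
From HB Require Import structures.
From mathcomp Require Import all_boot all_order all_algebra all_field.
From mathcomp Require Import finmap boolp classical_sets fsbigop.

Set Implicit Arguments.
Unset Strict Implicit.
Unset Printing Implicit Defensive.

Import GRing.Theory Num.Theory.
Local Open Scope ring_scope.

#[local] Obligation Tactic := idtac.

Record category := Category {
  Ob :> Type;
  Hom : Ob -> Ob -> Type;
  idm : forall X, Hom X X;
  mcomp : forall X Y Z, Hom Y Z -> Hom X Y -> Hom X Z;
  compA : forall W X Y Z (h : Hom Y Z) (g : Hom X Y) (f : Hom W X),
    mcomp h (mcomp g f) = mcomp (mcomp h g) f;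
  comp1m : forall X Y (f : Hom X Y), mcomp (idm Y) f = f;
  compm1 : forall X Y (f : Hom X Y), mcomp f (idm X) = f
}.

Arguments idm {c} X.

Notation "g \oc f" := (mcomp g f) (at level 40, left associativity).

Lemma comp_square (C : category) (X0 X1 X2 X3 X4 X5 Y1 Z1 : C)
    (a : Hom X4 X5) (b : Hom X3 X4) (c : Hom Y1 X5) (d : Hom X3 Y1)
    (e : Hom Z1 X4) (b' : Hom X2 Z1) (e' : Hom X2 X3)
    (g : Hom X1 X2) (f : Hom X0 X1) (w : Hom X1 Y1) :
  a \oc b = c \oc d -> b \oc e' = e \oc b' -> w = d \oc e' \oc g ->
  a \oc (e \oc (b' \oc (g \oc f))) = c \oc (w \oc f).
Proof.
by move=> E1 E2 ->; rewrite !compA -(compA a e) -E2 compA E1.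
Qed.

Definition is_iso (C : category) (X Y : C) (f : Hom X Y) : Prop :=
  exists g : Hom Y X, g \oc f = idm X /\ f \oc g = idm Y.

Definition isomorphic (C : category) (X Y : C) : Prop :=
  exists f : Hom X Y, is_iso f.

Record functor (C D : category) := Functor {
  fob :> C -> D;
  fmor : forall X Y, Hom X Y -> Hom (fob X) (fob Y);
  fmor_id : forall X, fmor (idm X) = idm (fob X);
  fmor_comp : forall X Y Z (g : Hom Y Z) (f : Hom X Y),
    fmor (g \oc f) = fmor g \oc fmor f
}.

Definition fid (C : category) : functor C C :=
  @Functor C C id (fun _ _ f => f) (fun=> erefl) (fun _ _ _ _ _ => erefl).

Program Definition fcomp (C D E : category)
    (G : functor D E) (F : functor C D) : functor C E :=
  @Functor C E (fun X => G (F X)) (fun _ _ f => fmor G (fmor F f)) _ _.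
Next Obligation. by move=> * /=; rewrite !fmor_id. Qed.
Next Obligation. by move=> * /=; rewrite !fmor_comp. Qed.

Definition natural (C D : category) (F G : functor C D)
    (a : forall X, Hom (F X) (G X)) : Prop :=
  forall X Y (f : Hom X Y), a Y \oc fmor F f = fmor G f \oc a X.

Definition nat_isomorphic (C D : category) (F G : functor C D) : Prop :=
  exists a : forall X, Hom (F X) (G X), natural a /\ forall X, is_iso (a X).

(* Localization in the sense that precomposition with Q is, for every E, an
   equivalence from the category of functors D -> E onto the category of the
   functors C -> E that invert W: the last two clauses are essential
   surjectivity and full faithfulness. *)
Definition is_localization (C D : category)
    (W : forall X Y : C, Hom X Y -> Prop) (Q : functor C D) : Prop :=
  [/\ forall (X Y : C) (f : Hom X Y), W X Y f -> is_iso (fmor Q f),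
      forall (E : category) (F : functor C E),
        (forall (X Y : C) (f : Hom X Y), W X Y f -> is_iso (fmor F f)) ->
        exists F' : functor D E, nat_isomorphic (fcomp F' Q) F
    & forall (E : category) (F G : functor D E)
        (a : forall X, Hom (fcomp F Q X) (fcomp G Q X)), natural a ->
        exists! b : forall Z, Hom (F Z) (G Z),
          natural b /\ forall X, b (Q X) = a X].

Record lincat (k : fieldType) := Lincat {
  lOb : Type;
  lHom : lOb -> lOb -> lmodType k;
  lidm : forall X, lHom X X;
  lcomp : forall X Y Z, lHom Y Z -> lHom X Y -> lHom X Z;
  lcompA : forall W X Y Z (h : lHom Y Z) (g : lHom X Y) (f : lHom W X),
    lcomp h (lcomp g f) = lcomp (lcomp h g) f;
  lcomp1m : forall X Y (f : lHom X Y), lcomp (lidm Y) f = f;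
  lcompm1 : forall X Y (f : lHom X Y), lcomp f (lidm X) = f;
  lcomp_linr : forall X Y Z (g : lHom Y Z),
    linear (lcomp g : lHom X Y -> lHom X Z);
  lcomp_linl : forall X Y Z (f : lHom X Y),
    linear ((fun g => lcomp g f) : lHom Y Z -> lHom X Z)
}.

Definition cat_of (k : fieldType) (D : lincat k) : category :=
  @Category (lOb D) (fun X Y => lHom X Y) (@lidm k D) (@lcomp k D)
    (@lcompA k D) (@lcomp1m k D) (@lcompm1 k D).

Coercion cat_of : lincat >-> category.

Definition linear_functor (k : fieldType) (C D : lincat k) (F : functor C D) :
    Prop :=
  forall X Y : C, linear (@fmor C D F X Y : lHom X Y -> lHom (F X) (F Y)).

Record autoequiv (k : fieldType) (D : lincat k) := Autoequiv {
  aeq :> functor D D;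
  ainv : functor D D;
  aeq_linear : linear_functor aeq;
  ainv_linear : linear_functor ainv;
  aeqK : nat_isomorphic (fcomp ainv aeq) (fid D);
  ainvK : nat_isomorphic (fcomp aeq ainv) (fid D)
}.

Definition fiter (C : category) (F : functor C C) (n : nat) : functor C C :=
  iter n (fcomp F) (fid C).

Definition apow (k : fieldType) (D : lincat k) (F : autoequiv D) (z : int) :
    functor D D :=
  match z with
  | Posz n => fiter F n
  | Negz n => fiter (ainv F) n.+1
  end.

Record dsum (k : fieldType) (V : int -> lmodType k) := Dsum {
  dval :> forall p, V p;
  dfin : exists s : seq int, forall p, p \notin s -> dval p = 0
}.

Section DirectSum.
Context {k : fieldType} {V : int -> lmodType k}.
Implicit Types f g h : dsum V.

Lemma dsum_eq f g : (forall p, f p = g p) -> f = g.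
Proof.
case: f g => [f sf] [g sg] /= fg.
have {}fg : f = g by apply: functional_extensionality_dep.
by subst g; congr Dsum; apply: Prop_irrelevance.
Qed.

HB.instance Definition _ := gen_eqMixin (dsum V).
HB.instance Definition _ := gen_choiceMixin (dsum V).

Program Definition dsum0 : dsum V := @Dsum k V (fun=> 0) _.
Next Obligation. by exists [::]. Qed.

Program Definition dsum_opp f : dsum V := @Dsum k V (fun p => - f p) _.
Next Obligation.
by move=> f; case: (dfin f) => s sP; exists s => p /sP ->; rewrite oppr0.
Qed.

Program Definition dsum_add f g : dsum V := @Dsum k V (fun p => f p + g p) _.
Next Obligation.
move=> f g; case: (dfin f) (dfin g) => [s sP] [t tP].
by exists (s ++ t) => p; rewrite mem_cat negb_or => /andP[/sP-> /tP->]; rewrite addr0.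
Qed.

Program Definition dsum_scale (a : k) f : dsum V :=
  @Dsum k V (fun p => a *: f p) _.
Next Obligation.
by move=> a f; case: (dfin f) => s sP; exists s => p /sP ->; rewrite scaler0.
Qed.

Fact dsum_addA : associative dsum_add.
Proof. by move=> f g h; apply: dsum_eq => p /=; rewrite addrA. Qed.
Fact dsum_addC : commutative dsum_add.
Proof. by move=> f g; apply: dsum_eq => p /=; rewrite addrC. Qed.
Fact dsum_add0 : left_id dsum0 dsum_add.
Proof. by move=> f; apply: dsum_eq => p /=; rewrite add0r. Qed.
Fact dsum_addN : left_inverse dsum0 dsum_opp dsum_add.
Proof. by move=> f; apply: dsum_eq => p /=; rewrite addNr. Qed.
HB.instance Definition _ :=
  GRing.isZmodule.Build (dsum V) dsum_addA dsum_addC dsum_add0 dsum_addN.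

Fact dsum_scaleA a b f : dsum_scale a (dsum_scale b f) = dsum_scale (a * b) f.
Proof. by apply: dsum_eq => p /=; rewrite scalerA. Qed.
Fact dsum_scale1 : left_id 1 dsum_scale.
Proof. by move=> f; apply: dsum_eq => p /=; rewrite scale1r. Qed.
Fact dsum_scaleDr : right_distributive dsum_scale +%R.
Proof. by move=> a f g; apply: dsum_eq => p /=; rewrite scalerDr. Qed.
Fact dsum_scaleDl f : {morph dsum_scale^~ f : a b / a + b}.
Proof. by move=> a b; apply: dsum_eq => p /=; rewrite scalerDl. Qed.
HB.instance Definition _ := GRing.Zmodule_isLmodule.Build k (dsum V)
  dsum_scaleA dsum_scale1 dsum_scaleDr dsum_scaleDl.

Lemma dsum_linE (a : k) f g p : (a *: f + g) p = a *: f p + g p.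
Proof. by []. Qed.

End DirectSum.

(* A strong monoidal functor from the discrete monoidal category Z to the
   k-linear endofunctors of D, i.e. a coherent choice of the powers G^p of an
   autoequivalence G = zpow 1. It is determined by G up to monoidal isomorphism
   and exists for every G. The equations p + q = r and p = 0 are arguments of
   zmu and zeta so that no transport along equalities in int is needed. *)
Record zaction (k : fieldType) (D : lincat k) := Zaction {
  zpow :> int -> functor D D;
  zpow_linear : forall p, linear_functor (zpow p);
  zmu : forall p q r, p + q = r ->
    forall X : D, Hom (zpow p (zpow q X)) (zpow r X);
  zmu_natural : forall p q r (e : p + q = r),
    @natural D D (fcomp (zpow p) (zpow q)) (zpow r) (zmu e);
  zmu_iso : forall p q r (e : p + q = r) X, is_iso (zmu e X);
  zeta : forall p, p = 0 -> forall X : D, Hom X (zpow p X);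
  zeta_natural : forall p (e : p = 0), @natural D D (fid D) (zpow p) (zeta e);
  zeta_iso : forall p (e : p = 0) X, is_iso (zeta e X);
  zmuA : forall p q r pq qr pqr (epq : p + q = pq) (eqr : q + r = qr)
      (el : pq + r = pqr) (er : p + qr = pqr) (X : D),
    zmu el X \oc zmu epq (zpow r X) = zmu er X \oc fmor (zpow p) (zmu eqr X);
  zmu1m : forall o p (eo : o = 0) (e : o + p = p) (X : D),
    zmu e X \oc zeta eo (zpow p X) = idm (zpow p X);
  zmum1 : forall o p (eo : o = 0) (e : p + o = p) (X : D),
    zmu e X \oc fmor (zpow p) (zeta eo X) = idm (zpow p X)
}.


Section LinearFacts.
Context {k : fieldType} {U V : lmodType k} (u : U -> V) (ulin : linear u).

Lemma lin0 : u 0 = 0.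
Proof.
by have := ulin (-1) 0 0; rewrite scaler0 addr0 scaleN1r addNr.
Qed.

Lemma linD x y : u (x + y) = u x + u y.
Proof. by have := ulin 1 x y; rewrite !scale1r. Qed.

Lemma lin_sum (I : Type) (s : seq I) (F : I -> U) :
  u (\sum_(i <- s) F i) = \sum_(i <- s) u (F i).
Proof. exact: (big_morph u linD lin0). Qed.

End LinearFacts.

Lemma fsum_fset (V : nmodType) (A : {fset int}) (F : int -> V) :
  (forall p, p \notin A -> F p = 0) ->
  \sum_(p \in [set: int]) F p = \sum_(p <- A) F p.
Proof. exact: fsbigTE. Qed.

Lemma fsum_single (V : nmodType) (p0 : int) (F : int -> V) :
  (forall p, p != p0 -> F p = 0) -> \sum_(p \in [set: int]) F p = F p0.
Proof.
move=> F0; rewrite (@fsum_fset _ [fset p0]%fset) ?big_seq_fset1 //.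
by move=> p; rewrite inE => /F0.
Qed.

Lemma dsum_fset (k : fieldType) (V : int -> lmodType k) (f : dsum V) :
  exists A : {fset int}, forall p, p \notin A -> f p = 0.
Proof.
by case: (dfin f) => s sP; exists [fset p in s]%fset => p; rewrite !inE => /sP.
Qed.

Section Orbit.
Context {k : fieldType} {D : lincat k} (G : zaction D).
Implicit Types W X Y Z : lOb D.

Definition orbit_hom X Y : lmodType k := dsum (fun p : int => lHom X (G p Y)).

Let lc X Y Z (g : lHom Y Z) (f : lHom X Y) : lHom X Z := lcomp g f.
Let lG p X Y (f : lHom X Y) : lHom (G p X) (G p Y) := @fmor D D (G p) X Y f.
Let lmu p q r (e : p + q = r) X : lHom (G p (G q X)) (G r X) := zmu G e X.
Let leta p (e : p = 0) X : lHom X (G p X) := zeta G e X.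

Fact addr_subK (p r : int) : p + (r - p) = r.
Proof. by rewrite addrCA subrr addr0. Qed.

(* The composite X -> G^p Y -> G^p G^q Z -> G^r Z of two homogeneous maps. *)
Definition orbit_comp1 X Y Z p q r (e : p + q = r)
    (g : lHom Y (G q Z)) (f : lHom X (G p Y)) : lHom X (G r Z) :=
  lc (lmu e Z) (lc (lG p g) f).

Lemma orbit_comp1_linr X Y Z p q r (e : p + q = r) (g : lHom Y (G q Z)) :
  linear (orbit_comp1 (X := X) e g).
Proof. by move=> a f f'; rewrite /orbit_comp1 /lc !lcomp_linr. Qed.

Lemma orbit_comp1_linl X Y Z p q r (e : p + q = r) (f : lHom X (G p Y)) :
  linear (fun g : lHom Y (G q Z) => orbit_comp1 e g f).
Proof.
move=> a g g'; rewrite /orbit_comp1 /lc /lG.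
by rewrite (@zpow_linear k D G p _ _ a g g') lcomp_linl lcomp_linr.
Qed.

Lemma orbit_comp1A W X Y Z p q r pq qr pqr (epq : p + q = pq) (eqr : q + r = qr)
    (el : pq + r = pqr) (er : p + qr = pqr)
    (h : lHom Y (G r Z)) (g : lHom X (G q Y)) (f : lHom W (G p X)) :
  orbit_comp1 el h (orbit_comp1 epq g f) = orbit_comp1 er (orbit_comp1 eqr h g) f.
Proof.
have nat_mu := @zmu_natural k D G p q pq epq Y (G r Z) h.
have mA := @zmuA k D G p q r pq qr pqr epq eqr el er Z.
rewrite /orbit_comp1 /lc /lG.
apply: (@comp_square D W (G p X) (G p (G q Y)) (G p (G q (G r Z))) (G pq (G r Z))
  (G pqr Z) (G p (G qr Z)) (G pq Y) _ _ _ _ _ _ _ (fmor (G p) g) f _ mA nat_mu).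
rewrite -compA; apply: etrans (@fmor_comp D D (G p) _ _ _ _ _) _.
exact: congr1 (@fmor_comp D D (G p) _ _ _ _ _).
Qed.

Definition orbit_comp_val X Y Z (g : orbit_hom Y Z) (f : orbit_hom X Y)
    (r : int) : lHom X (G r Z) :=
  \sum_(p \in [set: int]) orbit_comp1 (addr_subK p r) (g (r - p)) (f p).

Lemma orbit_comp_valE X Y Z (g : orbit_hom Y Z) (f : orbit_hom X Y) r
    (A : {fset int}) : (forall p, p \notin A -> f p = 0) ->
  orbit_comp_val g f r =
  \sum_(p <- A) orbit_comp1 (addr_subK p r) (g (r - p)) (f p).
Proof.
move=> fA; apply: fsum_fset => p /fA ->; exact: (lin0 (orbit_comp1_linr _ _)).
Qed.

Lemma orbit_comp_supp X Y Z (g : orbit_hom Y Z) (f : orbit_hom X Y)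
    (A B : {fset int}) r :
  (forall p, p \notin A -> f p = 0) -> (forall q, q \notin B -> g q = 0) ->
  (forall p q, p \in A -> q \in B -> p + q != r) -> orbit_comp_val g f r = 0.
Proof.
move=> fA gB rAB; rewrite (orbit_comp_valE _ _ fA) big_seq big1 // => p pA.
rewrite gB; first exact: (lin0 (orbit_comp1_linl _ _)).
by apply/negP => qB; have := rAB _ _ pA qB; rewrite addr_subK eqxx.
Qed.

Fact orbit_comp_fin X Y Z (g : orbit_hom Y Z) (f : orbit_hom X Y) :
  exists s : seq int, forall r, r \notin s -> orbit_comp_val g f r = 0.
Proof.
have [A fA] := dsum_fset f; have [B gB] := dsum_fset g.
exists [seq p + q | p <- A, q <- B] => r rAB.
apply: (orbit_comp_supp fA gB) => p q pA qB; apply: contra rAB => /eqP <-.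
by apply/allpairsP; exists (p, q).
Qed.

Definition orbit_comp X Y Z (g : orbit_hom Y Z) (f : orbit_hom X Y) :
  orbit_hom X Z := Dsum (orbit_comp_fin g f).

Definition orbit_proj_val X Y (f : lHom X Y) (p : int) : lHom X (G p Y) :=
  if @eqP _ p 0 is ReflectT e then lc (leta e Y) f else 0.

Fact orbit_proj_fin X Y (f : lHom X Y) :
  exists s : seq int, forall p, p \notin s -> orbit_proj_val f p = 0.
Proof.
by exists [:: 0] => p; rewrite inE /orbit_proj_val; case: eqP.
Qed.

Definition orbit_proj_mor X Y (f : lHom X Y) : orbit_hom X Y :=
  Dsum (orbit_proj_fin f).

Definition orbit_id X : orbit_hom X X := orbit_proj_mor (lidm X).

Fact orbit_compA W X Y Z (h : orbit_hom Y Z) (g : orbit_hom X Y)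
    (f : orbit_hom W X) :
  orbit_comp h (orbit_comp g f) = orbit_comp (orbit_comp h g) f.
Proof.
apply: dsum_eq => r /=.
have [A fA] := dsum_fset f; have [B gB] := dsum_fset g.
pose C := [fset ((p : int) + (q : int) : int)%R | p in A, q in B]%fset.
have inC p q : p \in A -> q \in B -> p + q \in C.
  by move=> pA qB; apply/imfset2P; exists p => //; exists q.
rewrite (orbit_comp_valE _ _ fA) (@orbit_comp_valE _ _ _ h _ r C); last first.
  move=> q qC; apply: (orbit_comp_supp fA gB) => p q' pA q'B.
  by apply: contra qC => /eqP <-; exact: inC.
under eq_bigr => q _ do
  rewrite /= (orbit_comp_valE _ _ fA) (lin_sum (orbit_comp1_linr _ _)).
rewrite exchange_big /= big_seq [RHS]big_seq; apply: eq_bigr => p pA.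
rewrite -fsum_fset; last first.
  move=> q qC; rewrite gB.
    by rewrite (lin0 (orbit_comp1_linl _ _)) (lin0 (orbit_comp1_linr _ _)).
  by apply: contra qC => qB; rewrite -(addr_subK p q); exact: inC.
rewrite (reindex_fsbigT (fun q : int => p + q)); last first.
  by exists (fun q => - p + q) => q; rewrite addrA ?addNr ?subrr add0r.
rewrite (@fsum_fset _ B); last first.
  move=> q qB; rewrite gB; last by rewrite addrC addKr.
  by rewrite (lin0 (orbit_comp1_linl _ _)) (lin0 (orbit_comp1_linr _ _)).
rewrite /orbit_comp_val (@fsum_fset _ B); last first.
  by move=> q /gB ->; exact: (lin0 (orbit_comp1_linr _ _)).
rewrite (lin_sum (orbit_comp1_linl _ _)); apply: eq_bigr => q _.
move: (addr_subK _ _) (addr_subK _ _) (addr_subK _ _) (addr_subK _ _).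
have -> : p + q - p = q by rewrite addrC addKr.
have -> : r - (p + q) = r - p - q by rewrite opprD addrA.
by move=> *; exact: orbit_comp1A.
Qed.

Fact orbit_comp1m X Y (f : orbit_hom X Y) : orbit_comp (orbit_id Y) f = f.
Proof.
apply: dsum_eq => r /=; rewrite /orbit_comp_val (@fsum_single _ r); last first.
  move=> p /eqP pr; rewrite /= /orbit_proj_val; case: eqP => [e|_].
    by case: pr; apply/esym/subr0_eq.
  exact: (lin0 (orbit_comp1_linl _ _)).
rewrite /= /orbit_proj_val; move: (addr_subK _ _); case: eqP => [e1 e2|]; last first.
  by rewrite subrr.
rewrite /orbit_comp1 /lc /lG lcompm1 lcompA.
by have := zmum1 G e1 e2 Y; rewrite /= => ->; exact: lcomp1m.
Qed.

Lemma orbit_comp_projE X Y Z (g : orbit_hom Y Z) (f : lHom X Y) r :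
  orbit_comp g (orbit_proj_mor f) r = lcomp (g r) f.
Proof.
rewrite /= /orbit_comp_val (@fsum_single _ 0); last first.
  move=> p /eqP p0; rewrite /= /orbit_proj_val; case: eqP => // _.
  exact: (lin0 (orbit_comp1_linr _ _)).
rewrite /= /orbit_proj_val; case: eqP => // e1; move: (addr_subK _ _).
rewrite subr0 => e2; rewrite /orbit_comp1 /lc /lG /lmu /leta.
have /= E1 := @zeta_natural k D G 0 e1 Y (G r Z) (g r).
have /= E2 := zmu1m G e1 e2 Z.
by rewrite (@lcompA k D X Y (G 0 Y) (G 0 (G r Z))) -E1 -lcompA lcompA E2 lcomp1m.
Qed.

Fact orbit_compm1 X Y (f : orbit_hom X Y) : orbit_comp f (orbit_id X) = f.
Proof. by apply: dsum_eq => r; rewrite orbit_comp_projE lcompm1. Qed.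

Fact orbit_comp_linr X Y Z (g : orbit_hom Y Z) :
  linear (orbit_comp g : orbit_hom X Y -> orbit_hom X Z).
Proof.
move=> a f f'; apply: dsum_eq => r /=.
have [A fA] := dsum_fset f; have [A' fA'] := dsum_fset f'.
have fU p : p \notin (A `|` A')%fset -> f p = 0.
  by rewrite in_fsetU negb_or => /andP[/fA].
have fU' p : p \notin (A `|` A')%fset -> f' p = 0.
  by rewrite in_fsetU negb_or => /andP[_ /fA'].
have fU2 p : p \notin (A `|` A')%fset -> (a *: f + f') p = 0.
  by move=> pU /=; rewrite fU // fU' // scaler0 addr0.
rewrite (orbit_comp_valE _ _ fU2) (orbit_comp_valE _ _ fU).
rewrite (orbit_comp_valE _ _ fU') scaler_sumr -big_split /=.
by apply: eq_bigr => p _; exact: orbit_comp1_linr.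
Qed.

Fact orbit_comp_linl X Y Z (f : orbit_hom X Y) :
  linear ((fun g => orbit_comp g f) : orbit_hom Y Z -> orbit_hom X Z).
Proof.
move=> a g g'; apply: dsum_eq => r /=; have [A fA] := dsum_fset f.
rewrite !(orbit_comp_valE _ _ fA) scaler_sumr -big_split /=.
by apply: eq_bigr => p _; exact: orbit_comp1_linl.
Qed.

Definition orbit_cat : lincat k :=
  Lincat orbit_compA orbit_comp1m orbit_compm1 orbit_comp_linr orbit_comp_linl.

Fact orbit_proj_comp X Y Z (g : lHom Y Z) (f : lHom X Y) :
  orbit_proj_mor (lcomp g f) = orbit_comp (orbit_proj_mor g) (orbit_proj_mor f).
Proof.
apply: dsum_eq => r; rewrite orbit_comp_projE /= /orbit_proj_val.
case: eqP => [e|_]; first exact: lcompA.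
by rewrite (lin0 (@lcomp_linl k D X Y (G r Z) f)).
Qed.

Definition orbit_proj : functor D orbit_cat :=
  @Functor D orbit_cat id (fun X Y f => orbit_proj_mor f) (fun=> erefl)
    (fun X Y Z g f => orbit_proj_comp g f).

End Orbit.

Definition fingen (R : nzRingType) (M : lmodType R) : Prop :=
  exists (n : nat) (e : 'I_n -> M),
    forall x, exists c : 'I_n -> R, x = \sum_i c i *: e i.

(* Serre duality Hom(X, Y) ~ Hom(Y, S X)^*, natural in X and Y, in a Hom-finite
   category. *)
Definition serre_functor (k : fieldType) (D : lincat k) (S : functor D D) :
    Prop :=
  (forall X Y : D, fingen (lHom X Y)) /\
  exists phi : forall X Y : D, lHom X Y -> {linear lHom Y (S X) -> k^o},
    [/\ forall X Y, bijective (phi X Y),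
        forall X Y (a : k) (f f' : lHom X Y) (g : lHom Y (S X)),
          phi X Y (a *: f + f') g = a * phi X Y f g + phi X Y f' g,
        forall X X' Y (u : lHom X' X) (f : lHom X Y) (g : lHom Y (S X')),
          phi X' Y (lcomp f u) g = phi X Y f (lcomp (fmor S u) g)
      & forall X Y Y' (v : lHom Y Y') (f : lHom X Y) (g : lHom Y' (S X)),
          phi X Y' (lcomp v f) g = phi X Y f (lcomp g v)].

(* The Auslander-Reiten translate of a triangulated category with Serre
   functor S and suspension Sigma is tau = S Sigma^-1; S being unique up to
   isomorphism, so is tau. *)
Definition ar_translate (k : fieldType) (D : lincat k)
    (Sigma tau : autoequiv D) : Prop :=
  serre_functor (fcomp tau Sigma).

Definition tau_shift (k : fieldType) (D : lincat k) (tau Sigma : autoequiv D)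
    (s t : int) : functor D D :=
  fcomp (apow tau s) (apow Sigma t).

(* Subcategories are full and closed under isomorphism, hence given by
   predicates on objects. *)
Definition iso_closed (C : category) (T : C -> Prop) : Prop :=
  forall X Y : C, isomorphic X Y -> T X -> T Y.

Definition functorially_finite (C : category) (T : C -> Prop) : Prop :=
  (forall Z : C, exists (X : C) (f : Hom X Z), T X /\
     forall X' (g : Hom X' Z), T X' -> exists h : Hom X' X, g = f \oc h) /\
  (forall Z : C, exists (X : C) (f : Hom Z X), T X /\
     forall X' (g : Hom Z X'), T X' -> exists h : Hom X X', g = h \oc f).

Definition cluster_tilting (k : fieldType) (D : lincat k) (Sigma : autoequiv D)
    (n : nat) (T : D -> Prop) : Prop :=
  [/\ iso_closed T,
      functorially_finite T,
      forall Z : D, T Z <->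
        (forall (X : D) (i : nat), T X -> (0 < i < n)%N ->
           forall f : lHom X (apow Sigma i Z), f = 0)
    & forall Z : D, T Z <->
        (forall (X : D) (i : nat), T X -> (0 < i < n)%N ->
           forall f : lHom Z (apow Sigma i X), f = 0)].

(* F T = T, where F T is the closure under isomorphism of the image of T. *)
Definition periodic (C : category) (F : functor C C) (T : C -> Prop) : Prop :=
  forall Y : C, T Y <-> exists2 X : C, T X & isomorphic (F X) Y.

Definition preimage_subcat (C D : category) (P : functor C D) (T : D -> Prop) :
    C -> Prop :=
  fun X => T (P X).

Section Modules.
Context {R : nzRingType}.
Implicit Types M N P : lmodType R.

Definition mod_zero M : Prop := forall x : M, x = 0.

Definition mod_iso M N : Prop := exists f : {linear M -> N}, bijective f.

Definition projective P : Prop :=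
  forall M N (g : {linear M -> N}) (f : {linear P -> N}),
    (forall y, exists x, g x = y) ->
    exists h : {linear P -> M}, forall x, g (h x) = f x.

Definition indecomposable M : Prop :=
  ~ mod_zero M /\
  forall A B : lmodType R,
    mod_iso M (A * B)%type -> mod_zero A \/ mod_zero B.

End Modules.

(* Submodules are given as injective linear maps. *)
Definition hereditary (R : nzRingType) : Prop :=
  forall (P Q : lmodType R) (i : {linear Q -> P}),
    projective P -> injective i -> projective Q.

Definition representation_finite (R : nzRingType) : Prop :=
  exists (n : nat) (L : 'I_n -> lmodType R),
    forall M : lmodType R, fingen M -> indecomposable M ->
      exists i, mod_iso M (L i).

Record complex (R : nzRingType) := Complex {
  cx :> int -> lmodType R;
  dif : forall i, {linear cx i -> cx (i + 1)};
  difK : forall i x, dif (i + 1) (dif i x) = 0;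
  cx_fingen : forall i, fingen (cx i);
  cx_bounded : exists a b : int,
    forall i, (i < a) || (b < i) -> mod_zero (cx i)
}.

Record chain_map (R : nzRingType) (X Y : complex R) := ChainMap {
  cmap :> forall i, {linear X i -> Y i};
  cmap_dif : forall i x, dif Y i (cmap i x) = cmap (i + 1) (dif X i x)
}.

Lemma linear_ext (R : nzRingType) (M N : lmodType R) (f g : {linear M -> N}) :
  f =1 g -> f = g.
Proof.
case: f g => [f cf] [g cg] /= fg.
have {}fg : f = g by apply: functional_extensionality_dep.
subst g; case: cf cg => [[a1] [s1]] [[a2] [s2]].
by rewrite (Prop_irrelevance a1 a2) (Prop_irrelevance s1 s2).
Qed.

Lemma chain_map_ext (R : nzRingType) (X Y : complex R) (f g : chain_map X Y) :
  (forall i, f i =1 g i) -> f = g.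
Proof.
case: f g => [f cf] [g cg] /= fg.
have {}fg : f = g.
  by apply: functional_extensionality_dep => i; apply: linear_ext => x; exact: fg.
by subst g; congr ChainMap; apply: Prop_irrelevance.
Qed.

Section Complexes.
Context {R : nzRingType}.
Implicit Types X Y Z : complex R.

Program Definition chain_id X : chain_map X X :=
  @ChainMap R X X (fun=> idfun) _.
Next Obligation. by []. Qed.

Program Definition chain_comp X Y Z (g : chain_map Y Z) (f : chain_map X Y) :
  chain_map X Z := @ChainMap R X Z (fun i => g i \o f i) _.
Next Obligation. by move=> X Y Z g f i x /=; rewrite !cmap_dif. Qed.

Program Definition complex_cat : category :=
  @Category (complex R) (@chain_map R) chain_id chain_comp _ _ _.
Next Obligation. by move=> *; exact: chain_map_ext. Qed.
Next Obligation. by move=> *; exact: chain_map_ext. Qed.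
Next Obligation. by move=> *; exact: chain_map_ext. Qed.

(* X[1]^i = X^(i + 1), with differential -d. *)
Program Definition complex_shift X : complex R :=
  @Complex R (fun i => X (i + 1)) (fun i => \- (dif X (i + 1))) _ _ _.
Next Obligation. by move=> X i x /=; rewrite raddfN /= difK !oppr0. Qed.
Next Obligation. by move=> X i; exact: cx_fingen. Qed.
Next Obligation.
move=> X; have [a [b abP]] := cx_bounded X.
exists (a - 1), (b - 1) => i iab; apply: abP.
by rewrite -ltrBlDr -(ltrBrDr i a 1).
Qed.

Program Definition chain_shift X Y (f : chain_map X Y) :
  chain_map (complex_shift X) (complex_shift Y) :=
  @ChainMap R (complex_shift X) (complex_shift Y) (fun i => f (i + 1)) _.
Next Obligation. by move=> X Y f i x /=; rewrite raddfN /= cmap_dif. Qed.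

Program Definition shift_functor : functor complex_cat complex_cat :=
  @Functor complex_cat complex_cat complex_shift chain_shift _ _.
Next Obligation. by move=> *; exact: chain_map_ext. Qed.
Next Obligation. by move=> *; exact: chain_map_ext. Qed.

(* H^(i + 1)(f) is injective and surjective for all i, where
   H^(i + 1)(X) = ker (dif X (i + 1)) / im (dif X i). *)
Definition quasi_iso (X Y : complex_cat) (f : Hom X Y) : Prop :=
  forall i,
    (forall x : X (i + 1), dif X (i + 1) x = 0 ->
       (exists y : Y i, dif Y i y = cmap f (i + 1) x) ->
       exists x' : X i, dif X i x' = x) /\
    (forall y : Y (i + 1), dif Y (i + 1) y = 0 ->
       exists x : X (i + 1), dif X (i + 1) x = 0 /\
         exists y' : Y i, dif Y i y' = y - cmap f (i + 1) x).

End Complexes.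

Arguments complex_cat R : clear implicits.
Arguments shift_functor R : clear implicits.

(* D together with Q : C^b(mod H) -> D is the derived category D^b(H): the
   localization at the quasi-isomorphisms, with the k-linear structure induced
   by the pointwise one on chain maps. *)
Definition is_derived_category (k : fieldType) (H : falgType k) (D : lincat k)
    (Q : functor (complex_cat H) D) : Prop :=
  is_localization (@quasi_iso H) Q /\
  forall (X Y : complex_cat H) (f g h : chain_map X Y) (a : k),
    (forall i x, h i x = a%:A *: f i x + g i x) ->
    fmor Q h = a *: (fmor Q f : lHom (Q X) (Q Y)) + fmor Q g.

Definition is_suspension (k : fieldType) (H : falgType k) (D : lincat k)
    (Q : functor (complex_cat H) D) (Sigma : autoequiv D) : Prop :=
  nat_isomorphic (fcomp Q (shift_functor H)) (fcomp Sigma Q).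

(* Main.v *)
(* A Serre functor S amounts to a linear trace on each Hom(X, S X) such that
   every linear functional on Hom(X, Y) is tr(g -) for a unique g : Y -> S X,
   and such a trace determines S X up to isomorphism. The trace of D^b(H) on the
   degree 0 component of Hom_C(X, S X) = (+)_p Hom_D(X, G^p (S X)) has this
   property in the orbit category: a functional on Hom_C(X, Y) is represented
   degree by degree, and Hom-finiteness of C leaves only finitely many nonzero
   degrees. Hence the projection commutes on objects with the Serre functors,
   and so with tau^s[t]. As tau^s[t] is an autoequivalence on both sides and T
   is closed under isomorphism, periodicity lifts. *)

Require Import Defs.
From mathcomp Require Import all_boot all_order all_algebra all_field.
From HB Require Import structures.
From mathcomp Require Import finmap boolp.
(* [Hom] is shadowed by vector.v. *)
Import Defs.

Set Implicit Arguments.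
Unset Strict Implicit.
Unset Printing Implicit Defensive.

Import GRing.Theory.
Local Open Scope ring_scope.

(** * Isomorphisms, and functors with a quasi-inverse *)

Lemma isomorphic_refl (C : category) (X : C) : isomorphic X X.
Proof. by exists (idm X), (idm X); rewrite comp1m. Qed.

Lemma isomorphic_sym (C : category) (X Y : C) : isomorphic X Y -> isomorphic Y X.
Proof. by case=> f [g [gf fg]]; exists g, f. Qed.

Lemma is_iso_comp (C : category) (X Y Z : C) (g : Hom Y Z) (f : Hom X Y) :
  is_iso g -> is_iso f -> is_iso (g \oc f).
Proof.
case=> g' [g'g gg'] [f' [f'f ff']]; exists (f' \oc g'); split.
  by rewrite -compA (compA g') g'g comp1m.
by rewrite -compA (compA f) ff' comp1m.
Qed.

Lemma isomorphic_trans (C : category) (Y X Z : C) :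
  isomorphic X Y -> isomorphic Y Z -> isomorphic X Z.
Proof. by case=> f fi [g gi]; exists (g \oc f); exact: is_iso_comp. Qed.

Lemma isomorphic_functor (C D : category) (F : functor C D) (X Y : C) :
  isomorphic X Y -> isomorphic (F X) (F Y).
Proof.
case=> f [g [gf fg]]; exists (fmor F f), (fmor F g).
by rewrite -!fmor_comp gf fg !fmor_id.
Qed.

Lemma nat_isomorphic_ob (C D : category) (F G : functor C D) (X : C) :
  nat_isomorphic F G -> isomorphic (F X) (G X).
Proof. by case=> a [_ ai]; exists (a X); exact: ai. Qed.

Lemma nat_isomorphic_sym (C D : category) (F G : functor C D) :
  nat_isomorphic F G -> nat_isomorphic G F.
Proof.
case=> a [an ai]; pose b X := sval (cid (ai X)).
have bP X : b X \oc a X = idm (F X) /\ a X \oc b X = idm (G X).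
  exact: svalP (cid (ai X)).
exists b; split; last first.
  by move=> X; have [ba ab] := bP X; exists (a X).
move=> X Y f; have [_ ab] := bP X; have [ba _] := bP Y.
by rewrite -[fmor G f]compm1 -ab (compA (fmor G f)) -an !compA ba comp1m.
Qed.

Lemma nat_isomorphic_trans (C D : category) (G F K : functor C D) :
  nat_isomorphic F G -> nat_isomorphic G K -> nat_isomorphic F K.
Proof.
case=> a [an ai] [b [bn bi]]; exists (fun X => b X \oc a X); split.
  by move=> X Y f; rewrite -compA an !compA bn.
by move=> X; exact: is_iso_comp.
Qed.

Lemma inverse_faithful (C D : category) (F : functor C D) (K : functor D C) :
  nat_isomorphic (fcomp K F) (fid C) ->
  forall (X Y : C) (f g : Hom X Y), fmor F f = fmor F g -> f = g.
Proof.
case=> a [an ai] X Y f g fg; have [b [_ ab]] := ai X.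
have /= Ef := an X Y f; have /= Eg := an X Y g.
by rewrite -[f]compm1 -[g]compm1 -ab !compA -Ef -Eg fg.
Qed.

(** The preimage of [h] is [fmor K h] conjugated by the isomorphism from [K F] to the identity. Its
    image is [h] because [K], having [F] as quasi-inverse, is faithful. *)
Lemma inverse_full (C D : category) (F : functor C D) (K : functor D C) :
  nat_isomorphic (fcomp K F) (fid C) -> nat_isomorphic (fcomp F K) (fid D) ->
  forall (X Y : C) (h : Hom (F X) (F Y)), exists f, fmor F f = h.
Proof.
move=> KF FK X Y h; case: (KF) => a [an ai].
have [b [ba ab]] := ai X; have [b' [b'a _]] := ai Y.
exists (a Y \oc fmor K h \oc b); apply: (inverse_faithful FK).
have /= E := an X Y (a Y \oc fmor K h \oc b).
by rewrite -[LHS]comp1m -b'a -(compA b') E -!compA ba compm1 compA b'a comp1m.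
Qed.

(** * Finite-dimensional vector spaces and the traces of Serre functors *)

Lemma lin_pack {k : fieldType} {V W : lmodType k} (l : V -> W) :
  linear l -> {f : {linear V -> W} | f =1 l}.
Proof.
move=> ll.
pose m := GRing.isLinear.Build k V W *:%R l ll.
pose f : {linear V -> W} := HB.pack l m.
by exists f.
Qed.

(** A generating family of least size is linearly independent, so the chosen coordinates are unique,
    hence linear. *)
Lemma fingen_coordinates {k : fieldType} {W : lmodType k} : fingen W ->
  exists (n : nat) (e : 'I_n -> W) (c : 'I_n -> {linear W -> k^o}),
    forall x, x = \sum_i c i x *: e i.
Proof.
move=> Wfg; pose P n := `[< exists e : 'I_n -> W,
  forall x, exists c : 'I_n -> k, x = \sum_i c i *: e i >].
have exP : exists n, P n by case: Wfg => n Pn; exists n; apply/asboolP.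
case: (ex_minnP exP) => n /asboolP[e eP] nmin.
have free (c : 'I_n -> k) : \sum_i c i *: e i = 0 -> forall i, c i = 0.
  move=> c0 j; apply/eqP/negPn/negP => cj.
  case: n => [|n] in e eP nmin c c0 j cj *; first by case: j cj.
  suff /nmin : P n by rewrite ltnn.
  apply/asboolP; exists (e \o lift j) => x; have [d xd] := eP x.
  (* Subtracting [d j / c j] times the relation [c] removes [e j], which leaves a smaller generating
     family. *)
  exists (fun i => d (lift j i) - d j / c j * c (lift j i)).
  have : x = \sum_i (d i - d j / c j * c i) *: e i.
    under eq_bigr do rewrite scalerBl -scalerA.
    by rewrite sumrB -scaler_sumr c0 scaler0 subr0.
  by rewrite (bigD1_ord j) //= mulfVK // subrr scale0r add0r.
have [c cP] := choice eP.
have cl i : linear ((fun x => c x i) : W -> k^o).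
  move=> a x y; apply/eqP; rewrite -subr_eq0; apply/eqP.
  apply: (free (fun i => c (a *: x + y) i - (a * c x i + c y i))) => //.
  under eq_bigr do rewrite scalerBl scalerDl -scalerA.
  by rewrite sumrB big_split /= -scaler_sumr -!cP subrr.
exists n, e, (fun i => sval (lin_pack (cl i))) => x.
by rewrite [LHS]cP; apply: eq_bigr => i _; case: lin_pack => f /= ->.
Qed.

(** The pair [(S, tr)] represents the functor sending [Y] to the dual of Hom([X], [Y]), with [tr] as
    universal element. *)
Definition perfect_trace {k : fieldType} {D : lincat k} (X S : lOb D)
    (tr : lHom X S -> k^o) : Prop :=
  linear tr /\ forall (Y : lOb D) (l : lHom X Y -> k^o), linear l ->
    exists! g : lHom Y S, forall f, l f = tr (lcomp g f).

(** The trace is the image of the identity under Serre duality. Duality identifies Hom([X], [Y])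
    with the dual of Hom([Y], [S X]); finite dimension allows exchanging the two sides. *)
Lemma serre_perfect_trace {k : fieldType} {D : lincat k} (S : functor D D) :
  serre_functor S -> forall X : D,
  exists tr : lHom X (S X) -> k^o, perfect_trace tr.
Proof.
case=> fg [phi [phib phil _ phin]] X.
exists (phi X X (lidm X)); split; first exact: linearP.
have phiE (Y : D) f (g : lHom Y (S X)) : phi X Y f g = phi X X (lidm X) (lcomp g f).
  by rewrite -phin lcompm1.
move=> Y l ll; have [n [e [c cP]]] := fingen_coordinates (fg Y (S X)).
have [psi psiK Kpsi] := phib X Y.
have lphi g : linear ((fun f => phi X Y f g) : lHom X Y -> k^o).
  by move=> a f f'; exact: phil.
(* The [psi (c i)] form the family dual to [e], which forces the coordinates of a representing
   map. *)
pose w := \sum_i (l (psi (c i)) : k) *: e i.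
have decomp f : f = \sum_i (phi X Y f (e i) : k) *: psi (c i).
  apply: (can_inj psiK); apply: linear_ext => x.
  rewrite (lin_sum (lphi x)) [in LHS](cP x) linear_sum.
  apply: eq_bigr => i _; rewrite linearZ.
  have /= := lphi x (phi X Y f (e i)) (psi (c i)) 0.
  by rewrite addr0 (lin0 (lphi x)) addr0 Kpsi => ->; rewrite /GRing.scale /= mulrC.
exists w; split=> [f|w' w'P].
  rewrite -phiE [in LHS](decomp f) (lin_sum ll) /w linear_sum.
  apply: eq_bigr => i _; rewrite linearZ.
  have /= := ll (phi X Y f (e i)) (psi (c i)) 0.
  by rewrite addr0 (lin0 ll) addr0 => ->; rewrite /GRing.scale /= mulrC.
by rewrite (cP w') /w; apply: eq_bigr => i _; rewrite w'P -phiE Kpsi.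
Qed.

(** Uniqueness of representing objects: each trace factors through the other, and each composite
    represents the same functional as the identity. *)
Lemma perfect_trace_unique {k : fieldType} {D : lincat k} (X S S' : D)
    (tr : lHom X S -> k^o) (tr' : lHom X S' -> k^o) :
  perfect_trace tr -> perfect_trace tr' -> isomorphic S S'.
Proof.
move=> [trl trP] [trl' trP'].
have [u [uP _]] := trP' S tr trl; have [v [vP _]] := trP S' tr' trl'.
have [i [_ iP]] := trP S tr trl; have [i' [_ iP']] := trP' S' tr' trl'.
exists u, v; split.
  apply: etrans (iP (lidm S) _); first by apply/esym/iP => f; rewrite -lcompA -vP.
  by move=> f; rewrite lcomp1m.
apply: etrans (iP' (lidm S') _); first by apply/esym/iP' => f; rewrite -lcompA -uP.
by move=> f; rewrite lcomp1m.
Qed.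

(** * Perfect traces in the orbit category *)

Section OrbitTrace.
Context {k : fieldType} {D : lincat k} (G : zaction D).

Definition dsum_single_val (V : int -> lmodType k) (p : int) (u : V p) (q : int) :
    V q :=
  if @eqP _ p q is ReflectT e then ecast q (V q) e u else 0.

Fact dsum_single_fin (V : int -> lmodType k) (p : int) (u : V p) :
  exists s : seq int, forall q, q \notin s -> dsum_single_val u q = 0.
Proof.
by exists [:: p] => q; rewrite inE eq_sym /dsum_single_val; case: eqP.
Qed.

Definition dsum_single (V : int -> lmodType k) (p : int) (u : V p) : dsum V :=
  Dsum (dsum_single_fin u).

Lemma dsum_single_eq (V : int -> lmodType k) (p : int) (u : V p) :
  dsum_single u p = u.
Proof.
rewrite /= /dsum_single_val; case: eqP => // e.
by rewrite (eq_irrelevance e erefl).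
Qed.

Lemma dsum_single_neq (V : int -> lmodType k) (p q : int) (u : V p) :
  p != q -> dsum_single u q = 0.
Proof. by rewrite /= /dsum_single_val; case: eqP. Qed.

Lemma dsum_single_linear (V : int -> lmodType k) (p : int) :
  linear (@dsum_single V p).
Proof.
move=> a u v; apply: dsum_eq => q; rewrite dsum_linE.
have [<-|pq] := eqVneq p q; first by rewrite !dsum_single_eq.
by rewrite !dsum_single_neq // scaler0 addr0.
Qed.

Lemma dsum_linear_ext (V : int -> lmodType k) (W : lmodType k)
    (l l' : dsum V -> W) : linear l -> linear l' ->
  (forall p (u : V p), l (dsum_single u) = l' (dsum_single u)) -> l =1 l'.
Proof.
move=> ll ll' E f; have [A fA] := dsum_fset f.
have -> : f = \sum_(p <- A) dsum_single (f p).
  apply: dsum_eq => q.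
  have ev : linear ((fun g : dsum V => g q) : dsum V -> V q) by [].
  rewrite (lin_sum ev) -(@fsum_fset _ _ (fun p => dsum_single (f p) q)).
    rewrite (fsum_single (p0 := q)) ?dsum_single_eq // => p pq.
    exact: dsum_single_neq.
  by move=> p /fA ->; rewrite (lin0 (@dsum_single_linear V p)).
by rewrite !lin_sum //; apply: eq_bigr.
Qed.

(** A variable [q] with a proof of [p + q = r], in place of [r - p], spares later uses a transport
    between Hom spaces. *)
Lemma orbit_comp_single (X Y Z : lOb D) (g : orbit_hom G Y Z) (p q r : int)
    (e : p + q = r) (u : lHom X (G p Y)) :
  orbit_comp g (dsum_single u : orbit_hom G X Y) r = orbit_comp1 e (g q) u.
Proof.
rewrite -[LHS]/(orbit_comp_val g (dsum_single u : orbit_hom G X Y) r).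
rewrite /orbit_comp_val (fsum_single (p0 := p)); last first.
  move=> p' p'p; rewrite dsum_single_neq 1?eq_sym //.
  exact: (lin0 (orbit_comp1_linr _ _)).
rewrite dsum_single_eq.
move: (addr_subK p r); have <- : q = r - p by rewrite -e addrC addKr.
by move=> e'; rewrite (eq_irrelevance e' e).
Qed.

(** [G q] is a quasi-inverse of [G p], since both composites are isomorphic to [G 0] and hence to
    the identity. *)
Lemma zpow_fullfaithful (p q : int) (e : p + q = 0) (X Y : D)
    (h : Hom (G p X) (G p Y)) : exists! f : Hom X Y, fmor (G p) f = h.
Proof.
have inv a b : a + b = 0 -> nat_isomorphic (fcomp (G a) (G b)) (fid D).
  move=> ab; apply: (nat_isomorphic_trans (G := G 0)).
    exists (zmu G ab); split; [exact: zmu_natural | exact: zmu_iso].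
  apply: nat_isomorphic_sym; exists (zeta G erefl).
  split; [exact: zeta_natural | exact: zeta_iso].
have qp : q + p = 0 by rewrite addrC.
have [f fh] := inverse_full (inv _ _ qp) (inv _ _ e) h.
exists f; split=> // f' f'h; apply: (inverse_faithful (inv _ _ qp)).
by rewrite fh f'h.
Qed.

(** Placed in degree [p], the map [u] is a combination of finitely many generators, each of finite
    support. *)
Lemma orbit_hom_support (X Y : lOb D) : fingen (orbit_hom G X Y) ->
  exists s : seq int, forall p (u : lHom X (G p Y)), p \notin s -> u = 0.
Proof.
case=> n [e eP]; have [s sP] := choice (fun i => dfin (e i)).
exists (flatten [seq s i | i <- enum 'I_n]) => p u ps.
have [c cu] := eP (dsum_single u : orbit_hom G X Y).
rewrite -(@dsum_single_eq (fun p => lHom X (G p Y)) p u) cu.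
have ev : linear ((fun g : orbit_hom G X Y => g p) :
  orbit_hom G X Y -> lHom X (G p Y)) by [].
rewrite (lin_sum ev) big1 // => i _ /=; rewrite (sP i) ?scaler0 //.
apply: contra ps => pi; apply/flattenP; exists (s i) => //.
by apply: map_f; rewrite mem_enum.
Qed.

Lemma orbit_perfect_trace (X S : D) (tr : lHom X S -> k^o) :
  (forall Y : lOb D, fingen (orbit_hom G X Y)) -> perfect_trace tr ->
  exists tr' : orbit_hom G X S -> k^o, perfect_trace (D := orbit_cat G) tr'.
Proof.
move=> fg [trl trP].
have [z [zz' zz]] := zeta_iso G (erefl : 0 = 0 :> int) S.
(* This is the adjunction bijection from Hom([Y], [G q S]) to Hom([G p Y], [S]): apply [G p], then
   identify [G p (G q S)] with [S] through [G 0 S]. *)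
pose comp0 (Y : lOb D) (p q : int) (e : p + q = 0) (g : lHom Y (G q S)) :
    lHom (G p Y) S :=
  lcomp (z : lHom (G 0 S) S)
    (lcomp (zmu G e S : lHom (G p (G q S)) (G 0 S)) (fmor (G p) g)).
have comp0_bij (Y : lOb D) (p q : int) (e : p + q = 0) (h : lHom (G p Y) S) :
    exists! g : lHom Y (G q S), comp0 Y p q e g = h.
  have [w [wm mw]] := zmu_iso G e S.
  have [g [gP gU]] := zpow_fullfaithful e (w \oc (zeta G erefl S \oc h)).
  exists g; split=> [|g' g'P].
    have -> : comp0 Y p q e g = z \oc (zmu G e S \oc fmor (G p) g) by [].
    by rewrite gP (compA (zmu G e S)) mw comp1m compA zz' comp1m.
  apply: gU; rewrite -g'P.
  have -> : comp0 Y p q e g' = z \oc (zmu G e S \oc fmor (G p) g') by [].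
  by rewrite (compA (zeta G erefl S)) zz comp1m compA wm comp1m.
pose tr' (h : orbit_hom G X S) : k^o := tr (lcomp (z : lHom (G 0 S) S) (h 0)).
have tr'l : linear tr'.
  by move=> a f f'; rewrite /tr' dsum_linE lcomp_linr trl.
(* Under [tr'], a map of degree [p] pairs only with the component of degree [- p]. *)
have tr'_single (Y : lOb D) (p q : int) (e : p + q = 0) (g : orbit_hom G Y S)
      (u : lHom X (G p Y)) :
    tr' (orbit_comp g (dsum_single u : orbit_hom G X Y)) =
    tr (lcomp (comp0 Y p q e (g q)) u).
  by rewrite /tr' (orbit_comp_single _ e) /orbit_comp1 /comp0 !lcompA.
suff perf (Y : lOb D) (l : orbit_hom G X Y -> k^o) : linear l ->
    exists! g : orbit_hom G Y S, forall f, l f = tr' (orbit_comp g f).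
  by exists tr'; split.
move=> ll.
have hP p : exists h : lHom (G p Y) S,
    forall u : lHom X (G p Y), l (dsum_single u) = tr (lcomp h u).
  have lp : linear ((fun u => l (dsum_single u)) : lHom X (G p Y) -> k^o).
    by move=> a u v; rewrite dsum_single_linear ll.
  by have [h [hP _]] := trP _ _ lp; exists h.
have gP q : exists g : lHom Y (G q S), forall u : lHom X (G (- q) Y),
    l (dsum_single u) = tr (lcomp (comp0 Y _ _ (addNr q) g) u).
  have [h hE] := hP (- q); have [g [gE _]] := comp0_bij Y _ _ (addNr q) h.
  by exists g; rewrite gE.
(* Nondegeneracy: a component of degree [q] is determined by its pairings with the maps of degree
   [- q]. *)
have gU q (g g' : lHom Y (G q S)) :
    (forall u : lHom X (G (- q) Y), tr (lcomp (comp0 Y _ _ (addNr q) g) u) =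
      tr (lcomp (comp0 Y _ _ (addNr q) g') u)) -> g = g'.
  move=> gg'; have [g0 [_ g0U]] := comp0_bij Y _ _ (addNr q) (comp0 Y _ _ (addNr q) g).
  rewrite -(g0U g) // -(g0U g') //.
  pose l' u := tr (lcomp (comp0 Y _ _ (addNr q) g) u).
  have l'l : linear (l' : lHom X (G (- q) Y) -> k^o).
    by move=> a u v; rewrite /l' lcomp_linr trl.
  have [h0 [_ h0U]] := trP _ _ l'l.
  by rewrite -(h0U (comp0 Y _ _ (addNr q) g)) // -(h0U (comp0 Y _ _ (addNr q) g')).
have [t tP] := orbit_hom_support (fg Y).
pose g q := sval (cid (gP q)).
have gfin : exists t' : seq int, forall q, q \notin t' -> g q = 0.
  (* For these [q] every [u] of degree [- q] is zero, so [g q] and [0] have equal pairings. *)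
  exists [seq - p | p <- t] => q qt; apply: gU => u.
  rewrite (tP _ u) ?(lin0 (@lcomp_linr _ _ _ _ _ _)) //.
  by apply: contra qt => qt; apply/mapP; exists (- q); rewrite ?opprK.
exists (Dsum gfin); split=> [f|g' g'P].
  apply: (dsum_linear_ext (l' := fun f => tr' (orbit_comp (Dsum gfin) f))) => //.
    by move=> a f1 f2; rewrite orbit_comp_linr tr'l.
  (* As [g q] was chosen for maps of degree [- q], the degree [p] is written as [- (- p)]. *)
  move=> p; rewrite -(opprK p) => u.
  by rewrite (tr'_single _ _ _ (addNr (- p))); exact: (svalP (cid (gP (- p))) u).
apply: dsum_eq => q; apply: gU => u.
rewrite -(tr'_single _ _ _ (addNr q) g') -[tr' _]g'P.
by rewrite [RHS](svalP (cid (gP q))).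
Qed.

End OrbitTrace.

(** * Functors that correspond on objects under a projection *)

Definition intertwines (C D : category) (P : functor D C) (A : functor D D)
    (F : functor C C) : Prop :=
  forall X : D, isomorphic (P (A X)) (F (P X)).

Lemma intertwines_comp (C D : category) (P : functor D C) (A B : functor D D)
    (F K : functor C C) :
  intertwines P A F -> intertwines P B K ->
  intertwines P (fcomp A B) (fcomp F K).
Proof.
move=> AF BK X; apply: isomorphic_trans (AF (B X)) _.
exact (isomorphic_functor F (BK X)).
Qed.

Lemma intertwines_iter (C D : category) (P : functor D C) (A : functor D D)
    (F : functor C C) (n : nat) :
  intertwines P A F -> intertwines P (fiter A n) (fiter F n).
Proof.
move=> AF; elim: n => [|n IHn]; first by move=> X; exact: isomorphic_refl.
exact: intertwines_comp AF IHn.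
Qed.

(** With [Z = ainv A X], the object [P Z] is isomorphic to [ainv F (F (P Z))], then to
    [ainv F (P (A Z))], and [A Z] to [X]. *)
Lemma intertwines_inv (k : fieldType) (C D : lincat k) (P : functor D C)
    (A : autoequiv D) (F : autoequiv C) :
  intertwines P A F -> intertwines P (ainv A) (ainv F).
Proof.
move=> AF X; pose Z := ainv A X.
have FK : isomorphic (ainv F (F (P Z))) (P Z) := nat_isomorphic_ob (P Z) (aeqK F).
have AK : isomorphic (A Z) X := nat_isomorphic_ob X (ainvK A).
apply: isomorphic_trans (isomorphic_sym FK) _.
apply: (isomorphic_functor (ainv F)).
apply: isomorphic_trans (isomorphic_sym (AF Z)) _.
exact: (isomorphic_functor P).
Qed.

Lemma intertwines_pow (k : fieldType) (C D : lincat k) (P : functor D C)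
    (A : autoequiv D) (F : autoequiv C) (z : int) :
  intertwines P A F -> intertwines P (apow A z) (apow F z).
Proof.
by move=> AF; case: z => n; apply: intertwines_iter => //; exact: intertwines_inv.
Qed.

(** * Powers of an autoequivalence on isomorphism classes *)

Lemma autoequiv_reflect (k : fieldType) (D : lincat k) (F : autoequiv D)
    (X Y : D) : isomorphic (F X) (F Y) -> isomorphic X Y.
Proof.
have FK Z : isomorphic (ainv F (F Z)) Z := nat_isomorphic_ob Z (aeqK F).
move=> /(isomorphic_functor (ainv F)) FXY.
exact: isomorphic_trans (isomorphic_sym (FK X)) (isomorphic_trans FXY (FK Y)).
Qed.

(** Exchanging the two functors lets the lemmas on iterates cover negative powers. *)
Definition autoequiv_inv (k : fieldType) (D : lincat k) (F : autoequiv D) :=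
  Autoequiv (ainv_linear F) (aeq_linear F) (ainvK F) (aeqK F).

Lemma iter_reflect (k : fieldType) (D : lincat k) (F : autoequiv D) (n : nat)
    (X Y : D) : isomorphic (fiter F n X) (fiter F n Y) -> isomorphic X Y.
Proof. by elim: n => // n IHn /autoequiv_reflect. Qed.

Lemma iter_surj (k : fieldType) (D : lincat k) (F : autoequiv D) (n : nat)
    (Y : D) : exists X : D, isomorphic (fiter F n X) Y.
Proof.
elim: n Y => [|n IHn] Y; first by exists Y; exact: isomorphic_refl.
have [X XY] := IHn (ainv F Y); exists X.
exact: isomorphic_trans (isomorphic_functor F XY) (nat_isomorphic_ob Y (ainvK F)).
Qed.

Lemma pow_reflect (k : fieldType) (D : lincat k) (F : autoequiv D) (z : int)
    (X Y : D) : isomorphic (apow F z X) (apow F z Y) -> isomorphic X Y.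
Proof.
by case: z => n; [exact: iter_reflect | exact: (iter_reflect (F := autoequiv_inv F))].
Qed.

Lemma pow_surj (k : fieldType) (D : lincat k) (F : autoequiv D) (z : int)
    (Y : D) : exists X : D, isomorphic (apow F z X) Y.
Proof. by case: z => n; [exact: iter_surj | exact: (iter_surj (autoequiv_inv F))]. Qed.

(** * Serre functors, Auslander-Reiten translates and periodicity *)

Lemma serre_intertwines (k : fieldType) (D : lincat k) (G : zaction D)
    (S : functor D D) (S' : functor (orbit_cat G) (orbit_cat G)) :
  serre_functor S -> serre_functor S' -> intertwines (orbit_proj G) S S'.
Proof.
(* Both [S X] and [S' X] carry a perfect trace for the same object [X] of the orbit category.
   Hom-finiteness of that category comes with [serS']. *)
move=> serS serS' X; have [tr trP] := serre_perfect_trace serS X.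
have fg (Y : lOb D) : fingen (orbit_hom G X Y) by exact: (proj1 serS' X Y).
have [tr' tr'P] := orbit_perfect_trace fg trP.
have [tr2 tr2P] := serre_perfect_trace serS' (X : orbit_cat G).
exact: perfect_trace_unique tr'P tr2P.
Qed.

(** The Serre functors are [tau] after the suspension, so the suspension is cancelled by writing [Y]
    as [SD Z]. *)
Lemma ar_translate_intertwines (k : fieldType) (D : lincat k) (G : zaction D)
    (SD tauD : autoequiv D) (SC tauC : autoequiv (orbit_cat G)) :
  ar_translate SD tauD -> ar_translate SC tauC ->
  intertwines (orbit_proj G) SD SC -> intertwines (orbit_proj G) tauD tauC.
Proof.
move=> tauD_AR tauC_AR SDC Y; pose P := orbit_proj G; pose Z := ainv SD Y.
have ZY : isomorphic (SD Z) Y := nat_isomorphic_ob Y (ainvK SD).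
have serre : isomorphic (P (tauD (SD Z))) (tauC (SC (P Z))).
  exact: serre_intertwines tauD_AR tauC_AR Z.
apply: isomorphic_trans
  (isomorphic_functor P (isomorphic_functor tauD (isomorphic_sym ZY))) _.
apply: isomorphic_trans serre _; apply: (isomorphic_functor tauC).
apply: isomorphic_trans (isomorphic_sym (SDC Z)) _.
exact: (isomorphic_functor P).
Qed.

Theorem lemma10 (k : fieldType) (H : falgType k)
    (H_hereditary : hereditary H) (H_finite : representation_finite H)
    (* D^b(H), its suspension and its Auslander-Reiten translate *)
    (D : lincat k) (Q : functor (complex_cat H) D)
    (D_derived : is_derived_category Q)
    (SD : autoequiv D) (SD_suspension : is_suspension Q SD)
    (tauD : autoequiv D) (tauD_AR : ar_translate SD tauD)
    (* C_m(H) = D^b(H) / G with G = tau^-1[m-1] *)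
    (m : nat) (m_ge2 : (2 <= m)%N)
    (G : zaction D) (GE : nat_isomorphic (G 1) (tau_shift tauD SD (-1) (m%:Z - 1)))
    (SC : autoequiv (orbit_cat G))
    (SC_suspension :
      nat_isomorphic (fcomp (orbit_proj G) SD) (fcomp SC (orbit_proj G)))
    (tauC : autoequiv (orbit_cat G)) (tauC_AR : ar_translate SC tauC)
    (n : nat) (T : orbit_cat G -> Prop) (T_ct : cluster_tilting SC n T)
    (s t : int) (T_periodic : periodic (tau_shift tauC SC s t) T) :
  periodic (tau_shift tauD SD s t) (preimage_subcat (orbit_proj G) T).
Proof.
have SDC : intertwines (orbit_proj G) SD SC.
  by move=> X; exact: nat_isomorphic_ob X SC_suspension.
have tauDC := ar_translate_intertwines tauD_AR tauC_AR SDC.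
have FDC : intertwines (orbit_proj G) (tau_shift tauD SD s t) (tau_shift tauC SC s t).
  exact: intertwines_comp (intertwines_pow s tauDC) (intertwines_pow t SDC).
have [T_iso _ _ _] := T_ct.
move=> Y; split=> [TY|[X TX XY]].
  (* Essential surjectivity of the powers in the derived category yields the candidate [X]. *)
  have [Z ZY] := pow_surj tauD s Y; have [X XZ] := pow_surj SD t Z.
  have FXY : isomorphic (tau_shift tauD SD s t X) Y.
    exact: isomorphic_trans (isomorphic_functor (apow tauD s) XZ) ZY.
  exists X => //.
  (* Periodicity of [T] gives [X'] in [T] with the same image as the projection of [X], up to
     isomorphism. Powers reflect isomorphism, so closure of [T] puts that projection in [T]. *)
  have [X' TX' X'Y] := (T_periodic (orbit_proj G Y)).1 TY.
  apply: (T_iso X') TX'; apply: (@pow_reflect _ _ SC t).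
  apply: (@pow_reflect _ _ tauC s); apply: isomorphic_trans X'Y _.
  apply: isomorphic_trans (FDC X).
  exact: isomorphic_functor (isomorphic_sym FXY).
apply/(T_periodic (orbit_proj G Y)); exists (orbit_proj G X) => //.
apply: isomorphic_trans (isomorphic_sym (FDC X)) _.
exact: isomorphic_functor XY.
Qed.
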